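(* Let $a<b$ be real numbers, let $\gamma_1,\gamma_2$ be kinetically admissible paths on $[a,b]$, and write $\xi_i:=\log\gamma_i$. Then for every $s\in[0,1]$, $$\mathcal{A}[\mathrm{interp}^\times(\gamma_1,\gamma_2,s)]\;\le\;(1-s)\,\mathcal{A}[\gamma_1]+s\,\mathcal{A}[\gamma_2]-\frac{s(1-s)}{2}\int_a^b\bigl(\dot\xi_1(t)-\dot\xi_2(t)\bigr)^2\,dt.$$ In particular, $\mathcal{A}$ is convex along geometric interpolation. Moreover, for $s\in(0,1)$ the displayed inequality is strict unless $\dot\xi_1=\dot\xi_2$ a.e. on $[a,b]$; equivalently, unless $\gamma_2/\gamma_1$ is constant on $[a,b]$.
   Context: For $a<b$, an admissible path on $[a,b]$ is an absolutely continuous function $\gamma:[a,b]\to(0,\infty)$ (strictly positive at every point) with $\dot\gamma\in L^2([a,b])$. Its log-coordinate is $\xi:=\log\gamma$, which is absolutely continuous with $\dot\xi=\dot\gamma/\gamma\in L^2([a,b])$. Put $K(v):=\cosh(v)-1$ for $v\in\mathbb{R}$. An admissible path $\gamma$ is kinetically admissible if $K(\dot\xi)\in L^1([a,b])$, i.e. $\int_a^b[\cosh(\dot\xi(t))-1]\,dt<\infty$. For a kinetically admissible path the kinetic action is $\mathcal{A}[\gamma]:=\int_a^b[\cosh(\dot\xi(t))-1]\,dt$. Geometric interpolation of admissible $\gamma_1,\gamma_2$ with $s\in[0,1]$ is $\mathrm{interp}^\times(\gamma_1,\gamma_2,s)(t):=\gamma_1(t)^{1-s}\gamma_2(t)^s$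 (it is kinetically admissible whenever $\gamma_1,\gamma_2$ are). *)

(* Defs.v *)
From HB Require Import structures.
From mathcomp Require Import all_boot all_order all_algebra.
From mathcomp Require Import all_classical all_reals all_analysis.
Import Order.TTheory GRing.Theory Num.Theory.
Import numFieldNormedType.Exports.

Set Implicit Arguments.
Unset Strict Implicit.
Unset Printing Implicit Defensive.

Local Open Scope classical_set_scope.
Local Open Scope ring_scope.

(* Paths on [a, b] are represented by total functions R -> R whose values
   outside [a, b] are irrelevant (they can only affect the derivative at the
   two endpoints). *)

Definition absolutely_continuous_on (R : realType) (a b : R) (f : R -> R) :=
  forall e : R, 0 < e -> exists2 d : R, 0 < d &
    forall (n : nat) (u v : 'I_n -> R),
      (forall i, [/\ a <= u i, u i <= v i & v i <= b]) ->
      trivIset [set: 'I_n] (fun i => `]u i, v i[%classic) ->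
      \sum_(i < n) (v i - u i) < d ->
      \sum_(i < n) `|f (v i) - f (u i)| < e.

(* [derive1 f] is the pointwise derivative; it is 0 by convention where f is not
   derivable, which for an absolutely continuous f is a null set. *)
Definition admissible (R : realType) (a b : R) (g : R -> R) :=
  [/\ absolutely_continuous_on a b g,
      {in `[a, b], forall t, 0 < g t} &
      (derive1 g \_ `[a, b]) \in Lfun (@lebesgue_measure R) 2%:E].

Definition logc (R : realType) (g : R -> R) : R -> R := fun t => ln (g t).

Definition cosh (R : realType) (v : R) : R := (expR v + expR (- v)) / 2.

Definition kinK (R : realType) (v : R) : R := cosh v - 1.

Definition kinetically_admissible (R : realType) (a b : R) (g : R -> R) :=
  admissible a b g /\
  (@lebesgue_measure R).-integrable `[a, b]
    (fun t => (kinK (derive1 (logc g) t))%:E).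

(* Extended-real valued, so that an infinite action is not read as 0. *)
Definition action (R : realType) (a b : R) (g : R -> R) : \bar R :=
  (\int[@lebesgue_measure R]_(t in `[a, b]) (kinK (derive1 (logc g) t))%:E)%E.

Definition interp (R : realType) (g1 g2 : R -> R) (s : R) : R -> R :=
  fun t => g1 t `^ (1 - s) * g2 t `^ s.

Definition convex_along_interp (R : realType) (a b : R)
    (F : (R -> R) -> \bar R) :=
  forall (g1 g2 : R -> R) (s : R),
    kinetically_admissible a b g1 -> kinetically_admissible a b g2 ->
    0 <= s <= 1 ->
    (F (interp g1 g2 s) <= (1 - s)%:E * F g1 + s%:E * F g2)%E.

Definition interp_bound (R : realType) (a b : R) (g1 g2 : R -> R) (s : R)
    : \bar R :=
  ((1 - s)%:E * action a b g1 + s%:E * action a b g2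
   - (s * (1 - s) / 2)%:E *
     \int[@lebesgue_measure R]_(t in `[a, b])
       ((derive1 (logc g1) t - derive1 (logc g2) t) ^+ 2)%:E)%E.

(* Main.v *)
Require Import Defs.
From HB Require Import structures.
From mathcomp Require Import all_boot all_order all_algebra.
From mathcomp Require Import all_classical all_reals all_analysis measurable_realfun.
From mathcomp Require Import ring lra.
Import Order.TTheory GRing.Theory Num.Theory.
Import numFieldNormedType.Exports.
Import HBNNSimple.

(** Along geometric interpolation the log-coordinates interpolate linearly, so
    everything reduces to the strict convexity of [kinK v - v ^+ 2 / 2], applied
    pointwise to the derivatives of the log-coordinates and integrated.

    The analytic input is that an absolutely continuous function is almost
    everywhere differentiable and is the integral of its derivative. Its total
    variation is again absolutely continuous, hence the function is a difference
    of two monotone absolutely continuous functions; the Lebesgue-Stieltjes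
    measure of each is absolutely continuous with respect to the Lebesgue
    measure, and its Radon-Nikodym density is the derivative at every Lebesgue
    point.

    The derivatives in the statement are pointwise ones and need not be
    measurable where the paths are not differentiable. They are replaced by the
    densities, and for the action of the interpolated path and the integral of
    the squared difference only upper bounds are needed, which hold without
    measurability. *)

Set Implicit Arguments.
Unset Strict Implicit.
Unset Printing Implicit Defensive.

Local Open Scope classical_set_scope.
Local Open Scope ring_scope.

(** * Finite families of intervals and total variation *)

(** Common endpoints are allowed, so that the consecutive cells of a partition qualify. *)
Definition nonoverlapping {R : realType} : rel (R * R) :=
  fun p q => (p.2 <= q.1) || (q.2 <= p.1).

Definition subintervals {R : realType} (a b : R) (s : seq (R * R)) :=
  all (fun p => [&& a <= p.1, p.1 <= p.2 & p.2 <= b]) s && pairwise nonoverlapping s.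

(** Sequences of pairs replace families indexed by ordinals because the refinement argument below
    concatenates and permutes families. *)
Lemma absolutely_continuous_on_seq {R : realType} (a b : R) (f : R -> R) :
  absolutely_continuous_on a b f ->
  forall e : R, 0 < e -> exists2 d : R, 0 < d &
    forall s : seq (R * R), subintervals a b s ->
      \sum_(p <- s) (p.2 - p.1) < d -> \sum_(p <- s) `|f p.2 - f p.1| < e.
Proof.
move=> acf e /acf[d d0 H]; exists d => // s /andP[sab sp] sd.
pose p0 : R * R := (0, 0).
rewrite (big_nth p0) big_mkord.
have := H (size s) (fun i => (nth p0 s i).1) (fun i => (nth p0 s i).2).
apply.
- by move=> i; have /(all_nthP p0)/(_ i (ltn_ord i))/and3P[] := sab.
- move=> i j _ _ [t []]; rewrite /= !in_itv/= => /andP[i1 i2] /andP[j1 j2].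
  have P k l : (k < l)%N -> (l < size s)%N -> nonoverlapping (nth p0 s k) (nth p0 s l).
    by move=> kl ls; apply: (pairwiseP p0 sp) => //; rewrite inE (ltn_trans kl).
  apply/val_inj; case: (ltngtP i j) => // ij.
  + have /orP[] := P _ _ ij (ltn_ord j) => h.
      by have := lt_le_trans i2 (le_trans h (ltW j1)); rewrite ltxx.
    by have := lt_le_trans j2 (le_trans h (ltW i1)); rewrite ltxx.
  + have /orP[] := P _ _ ij (ltn_ord i) => h.
      by have := lt_le_trans j2 (le_trans h (ltW i1)); rewrite ltxx.
    by have := lt_le_trans i2 (le_trans h (ltW j1)); rewrite ltxx.
- by move: sd; rewrite (big_nth p0) big_mkord.
Qed.

Lemma path_zip_subintervals {R : realType} (x y : R) (l : seq R) :
  itv_partition x y l -> subintervals x y (zip (x :: l) l) /\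
    \sum_(p <- zip (x :: l) l) (p.2 - p.1) = y - x.
Proof.
elim: l x => [x [_ /eqP <-]|z l IH x xl]; first by rewrite big_nil subrr.
have xz : x < z by case: xl => /= /andP[].
have zl : itv_partition z y l by exact: itv_partition_cons xl.
have zy := itv_partition_le zl.
have [/andP[al pl] sl] := IH _ zl.
rewrite /= big_cons/= sl; split; last by lra.
apply/andP; split => /=.
  rewrite lexx (ltW xz) zy/=; apply/allP => p /(allP al)/and3P[zp -> ->].
  by rewrite (le_trans (ltW xz) zp).
rewrite pl andbT; apply/allP => p /(allP al)/and3P[zp _ _].
by rewrite /nonoverlapping/= zp.
Qed.

Lemma subintervals_cons {R : realType} (a b : R) (p : R * R) s :
  subintervals a b (p :: s) =
  [&& [&& a <= p.1, p.1 <= p.2 & p.2 <= b], all (nonoverlapping p) s & subintervals a b s].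
Proof. by rewrite /subintervals/= andbACA -!andbA. Qed.

Lemma subintervals_catCA {R : realType} (a b : R) s t u :
  subintervals a b (s ++ (t ++ u)) = subintervals a b (t ++ (s ++ u)).
Proof.
rewrite /subintervals !all_cat !pairwise_cat !allrel_catr.
have -> : allrel nonoverlapping t s = allrel nonoverlapping s t.
  rewrite allrelC; apply: eq_allrel => p q; exact: orbC.
by rewrite -!andbA; do !bool_congr.
Qed.

Lemma subintervals_refine {R : realType} (a b : R) (p : R * R) s t :
  subintervals a b (p :: s) -> subintervals p.1 p.2 t -> subintervals a b (t ++ s).
Proof.
rewrite subintervals_cons => /and3P[/and3P[ap pp pb] ps /andP[sab sp]] /andP[tp tt].
apply/andP; split.
  rewrite all_cat sab andbT; apply/allP => q /(allP tp)/and3P[q1 -> q2].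
  by rewrite (le_trans ap q1) (le_trans q2 pb).
rewrite pairwise_cat tt sp !andbT; apply/allrelP => q r /(allP tp)/and3P[q1 _ q2].
move=> /(allP ps)/orP[h|h]; rewrite /nonoverlapping.
  by rewrite (le_trans q2 h).
by rewrite (le_trans h q1) orbT.
Qed.

Lemma variation_zip_pairs {R : realType} (x y : R) (f : R -> R) (l : seq R) :
  itv_partition x y l ->
  variation x y f l = \sum_(p <- zip (x :: l) l) `|f p.2 - f p.1|.
Proof.
move=> xyl; rewrite variation_zip//.
have swap (s t : seq R) : zip s t = [seq (p.2, p.1) | p <- zip t s].
  by elim: s t => [|u s IH] [|v t] //=; rewrite IH.
by rewrite swap big_map.
Qed.

(* The intervals are handled one at a time: their total variation is the
   supremum over partitions, each of which refines the family. *)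
Lemma sum_total_variation_le {R : realType} (a b d e : R) (f : R -> R) :
  (forall s, subintervals a b s -> \sum_(p <- s) (p.2 - p.1) < d ->
    \sum_(p <- s) `|f p.2 - f p.1| <= e) ->
  forall t s, subintervals a b (t ++ s) -> \sum_(p <- t ++ s) (p.2 - p.1) < d ->
  (\sum_(p <- t) total_variation p.1 p.2 f +
     (\sum_(p <- s) `|f p.2 - f p.1|)%:E <= e%:E)%E.
Proof.
move=> H; elim=> [s abs sd|p t IH s]; first by rewrite big_nil add0e lee_fin H.
rewrite cat_cons => abps psd.
have abts : subintervals a b (t ++ s).
  by move: abps; rewrite subintervals_cons => /and3P[].
have pp : p.1 <= p.2.
  by move: abps; rewrite subintervals_cons => /and3P[/and3P[]].
have TV0 : (0 <= \sum_(q <- t) total_variation q.1 q.2 f)%E.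
  rewrite big_seq; apply: sume_ge0 => q qt; apply: total_variation_ge0.
  have /andP[/allP/(_ q)] := abts.
  by rewrite mem_cat qt => /(_ isT)/and3P[].
have S0 : 0 <= \sum_(q <- s) `|f q.2 - f q.1| by exact: sumr_ge0.
(* Finiteness of [r] allows it to be moved to the right-hand side, where the total variation over
   [p] can be bounded partition by partition. *)
set r := (\sum_(q <- t) total_variation q.1 q.2 f +
  (\sum_(q <- s) `|f q.2 - f q.1|)%:E)%E.
have rle : (r <= e%:E)%E.
  apply: IH => //; apply: le_lt_trans psd.
  by rewrite big_cons lerDr subr_ge0.
have rfin : r \is a fin_num.
  rewrite ge0_fin_numE; first by rewrite (le_lt_trans rle)// ltry.
  by rewrite adde_ge0// lee_fin.
rewrite big_cons -addeA -/r -leeBrDr//.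
apply: ge_ereal_sup => _ [_ [l pl <-] <-].
rewrite leeBrDr// (variation_zip_pairs f pl) /r addeCA -EFinD -big_cat/=.
have [lp lsum] := path_zip_subintervals pl.
(* The cells of [l] replace [p] and join the intervals measured by plain increments, which leaves
   only [t] for the induction; the total length is unchanged. *)
have pe : perm_eq (zip (p.1 :: l) l ++ (t ++ s)) (t ++ (zip (p.1 :: l) l ++ s)).
  by rewrite !catA perm_cat2r perm_catC.
apply: IH; first by rewrite subintervals_catCA; exact: subintervals_refine abps lp.
by rewrite -(perm_big _ pe) big_cat/= lsum; move: psd; rewrite big_cons.
Qed.

Lemma absolutely_continuous_total_variation {R : realType} (a b : R) (f : R -> R) :
  absolutely_continuous_on a b f ->
  forall e : R, 0 < e -> exists2 d : R, 0 < d &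
    forall s : seq (R * R), subintervals a b s -> \sum_(p <- s) (p.2 - p.1) < d ->
      (\sum_(p <- s) total_variation p.1 p.2 f <= e%:E)%E.
Proof.
move=> /absolutely_continuous_on_seq ac e e0.
have [d d0 H] := ac e e0; exists d => // s abs sd.
have := @sum_total_variation_le _ a b d e f _ s [::].
by rewrite cats0 big_nil adde0; apply => // u abu ud; exact/ltW/H.
Qed.

Lemma subintervals1 {R : realType} (a b : R) (p : R * R) :
  subintervals a b [:: p] = [&& a <= p.1, p.1 <= p.2 & p.2 <= b].
Proof. by rewrite /subintervals/= !andbT. Qed.

(** Intervals shorter than [d] have total variation at most 1, and finitely many steps of length
    [d / 2] cover [[a, b]]. *)
Lemma absolutely_continuous_bounded_variation {R : realType} (a b : R) (f : R -> R) :
  a <= b -> absolutely_continuous_on a b f -> bounded_variation a b f.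
Proof.
move=> ab /absolutely_continuous_total_variation/(_ 1 ltr01)[d d0 H].
have small x y : a <= x -> x <= y -> y <= b -> y - x < d ->
    total_variation x y f \is a fin_num.
  move=> ax xy yb yxd; rewrite ge0_fin_numE ?total_variation_ge0//.
  apply: (@le_lt_trans _ _ 1%:E); last exact: ltry.
  by have := H [:: (x, y)]; rewrite subintervals1 !big_seq1/= ax xy yb; exact.
have n_tv (n : nat) x : a <= x -> x <= b -> x - a < n.+1%:R * (d / 2) ->
    total_variation a x f \is a fin_num.
  elim: n x => [|n IH] x ax xb xn; first by apply: small => //; lra.
  have [xd|dx] := ltP (x - a) (d / 2); first by apply: small => //; lra.
  have ay : a <= x - d / 2 by lra.
  have yx : x - d / 2 <= x by lra.
  rewrite (total_variationD f ay yx) fin_numD; apply/andP; split.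
    apply: IH => //; first by lra.
    by move: xn; rewrite mulrSr; lra.
  by apply: small => //; lra.
apply/bounded_variationP => //.
apply: (n_tv (Num.bound ((b - a) / (d / 2)))) => //.
have d20 : 0 < d / 2 by lra.
rewrite -ltr_pdivrMr//.
apply: lt_le_trans (archi_boundP _) _; first by rewrite divr_ge0 ?subr_ge0// ltW.
by rewrite ler_nat.
Qed.

(** * Densities of monotone absolutely continuous functions *)

(** The last inequality is weak because the bound on total variations comes from suprema. *)
Definition seq_absolutely_continuous {R : realType} (a b : R) (f : R -> R) :=
  forall e : R, 0 < e -> exists2 d : R, 0 < d &
    forall s : seq (R * R), subintervals a b s ->
      \sum_(p <- s) (p.2 - p.1) < d -> \sum_(p <- s) `|f p.2 - f p.1| <= e.

(** An open interval equals the interior of its hull, and an infinite endpoint would make its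
    measure infinite. *)
Lemma open_interval_finite_measure {R : realType} (X : set R) :
  open X -> is_interval X -> X !=set0 -> (lebesgue_measure X < +oo)%E ->
  exists p : R * R, p.1 < p.2 /\ X = `]p.1, p.2[%classic.
Proof.
move=> oX /is_intervalP XE X0.
have {}XE : X = [set` Rhull X]° by rewrite -XE; exact/esym/interior_id.
rewrite XE in X0 *; move: X0.
case: (Rhull X) => [[b1 x|[|]] [b2 y|[|]]]; rewrite ?interior_itv ?lebesgue_measure_itv/=.
all: rewrite ?set_itvE ?interior0 ?ltNyr ?ltry.
  move=> [z /andP[xz zy]] _.
  by exists (x, y); rewrite set_itvE; split => //=; exact: lt_trans xz zy.
all: by [case | rewrite /= ltxx].
Qed.

Section clamp.
Context {R : realType} (a b : R).
Hypothesis ab : a <= b.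

(** Composition with this nondecreasing 1-Lipschitz retraction onto [[a, b]] extends a monotone
    function on [[a, b]] to a cumulative function on the whole line. *)
Definition clamp (x : R) := Num.max a (Num.min b x).

Lemma clamp_ge x : a <= clamp x.
Proof. by rewrite le_max lexx. Qed.

Lemma clamp_le x : clamp x <= b.
Proof. by rewrite ge_max ab ge_min lexx. Qed.

Lemma clamp_id x : a <= x -> x <= b -> clamp x = x.
Proof. by move=> ax xb; rewrite /clamp (min_idPr xb) (max_idPr ax). Qed.

Lemma clamp_homo : {homo clamp : x y / x <= y}.
Proof.
move=> x y xy; rewrite /clamp ge_max !le_max lexx /= le_min !ge_min lexx/=.
by rewrite xy !orbT.
Qed.

Lemma clamp_dist x y : x <= y -> clamp y - clamp x <= y - x.
Proof.
rewrite /clamp => xy; case: (leP b x) => bx; case: (leP b y) => b_y;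
  case: (leP a _) => ?; try (case: (leP a _) => ?); lra.
Qed.

End clamp.

Section monotone_density.
Context {R : realType} (a b : R) (V : R -> R).
Hypothesis ab : a <= b.
Hypothesis Vnd : {in `[a, b] &, {homo V : x y / x <= y}}.
Hypothesis Vac : seq_absolutely_continuous a b V.

Let F x := V (clamp a b x).

Let F_nd : {homo F : x y / x <= y}.
Proof.
by move=> x y xy; apply: Vnd; rewrite ?in_itv/= ?clamp_ge ?clamp_le//; exact: clamp_homo.
Qed.

Let F_rc : right_continuous F.
Proof.
move=> x; apply/cvgrPdist_le => e /Vac[d d0 H].
near=> y.
have xy : x <= y by apply: ltW; near: y; exact: nbhs_right_gt.
have yd : y - x < d.
  by rewrite ltrBlDl; near: y; apply: nbhs_right_lt; rewrite ltrDl.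
rewrite distrC.
have := H [:: (clamp a b x, clamp a b y)].
rewrite subintervals1 !big_seq1/= clamp_ge clamp_le// clamp_homo//; apply => //.
exact: le_lt_trans (clamp_dist a b xy) yd.
Unshelve. all: by end_near. Qed.

HB.instance Definition _ := isCumulative.Build R _ R F F_nd F_rc.

Let mu : {measure set (measurableTypeR R) -> \bar R} :=
  lebesgue_stieltjes_measure (F : cumulative R R).

Let mu_itvoc u v : u <= v -> mu `]u, v]%classic = (F v - F u)%:E.
Proof.
move=> uv; rewrite -(wlength_itv_bnd F false false uv).
rewrite /mu/= /lebesgue_stieltjes_measure/= /measure_extension/=.
by rewrite measurable_mu_extE//; exact: is_ocitv.
Qed.

Let mu_itvoo u v : u <= v -> (mu `]u, v[%classic <= (F v - F u)%:E)%E.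
Proof.
move=> uv; rewrite -mu_itvoc//; apply: le_measure; rewrite ?inE//.
by apply: subset_itvl; rewrite bnd_simp.
Qed.

(** [U] is a countable disjoint union of open intervals. Finitely many of them, clamped to [[a, b]],
    form a family to which the hypothesis applies, and the bound passes to the limit. *)
Let mu_open (e d : R) (U : set R) :
  (forall s : seq (R * R), subintervals a b s ->
      \sum_(p <- s) (p.2 - p.1) < d -> \sum_(p <- s) `|V p.2 - V p.1| <= e) ->
  open U -> (lebesgue_measure U < d%:E)%E -> (mu U <= e%:E)%E.
Proof.
move=> H oU Ud.
have [I [oI tI UI]] := OpenSetDisjointItvs.open_disjoint_itv oU.
have mI q : measurable (I q) by apply: open_measurable; case: (oI q).
have IU q : I q `<=` U by rewrite UI => x Ix; exists q.
have Ioo q : (lebesgue_measure (I q) < +oo)%E.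
  apply: (@le_lt_trans _ _ (lebesgue_measure U)); last by rewrite (lt_trans Ud)// ltry.
  by apply: le_measure; rewrite ?inE; [exact: mI|exact: open_measurable|exact: IU].
have /choice[P PI] : forall q, exists p : R * R,
    p.1 <= p.2 /\ I q = `]p.1, p.2[%classic.
  move=> q; have [->|/set0P I0] := eqVneq (I q) set0.
    by exists (0, 0); split => //; rewrite set_itvoo0.
  have [p [pp pI]] := open_interval_finite_measure (oI q).1 (oI q).2 I0 (Ioo q).
  by exists p; split => //; exact: ltW.
rewrite UI measure_bigcup; [|by move=> q _; exact: mI|exact: tI].
apply: lime_le; first exact: is_cvg_nneseries.
apply: nearW => n.
under eq_bigl do rewrite in_setT.
(* Empty intervals are discarded: their endpoints may lie inside another interval, and disjointness
   of the sets says nothing about them. *)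
pose s := [seq (clamp a b (P q).1, clamp a b (P q).2) |
  q <- [seq q <- iota 0 n | (P q).1 < (P q).2]].
have le_s : (\sum_(0 <= q < n) mu (I q) <= (\sum_(p <- s) `|V p.2 - V p.1|)%:E)%E.
  rewrite /s big_map big_filter -sumEFin [leRHS]big_mkcond/= /index_iota subn0.
  apply: lee_sum => q _; have [p12 ->] := PI q.
  case: ifPn => [p1p2|]; last first.
    by rewrite -leNgt => p21; rewrite set_itv_ge ?measure0// bnd_simp -leNgt.
  by rewrite (le_trans (mu_itvoo p12))// lee_fin ler_norm.
apply: (le_trans le_s); rewrite lee_fin; apply: H.
- apply/andP; split.
    apply/allP => _ /mapP[q _ ->]/=; rewrite clamp_ge clamp_le//= andbT.
    by apply: clamp_homo; have [] := PI q.
  rewrite /s pairwise_map.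
  apply: (@sub_in_pairwise _ [pred q | (P q).1 < (P q).2] (fun q r => q != r)).
  + move=> q r; rewrite !inE => q1 r1 qr.
    have [qr1|rq1] := leP (P q).2 (P r).1.
      by rewrite /nonoverlapping/= clamp_homo.
    have [rq2|qr2] := leP (P r).2 (P q).1.
      by rewrite /nonoverlapping/= (clamp_homo a b rq2) orbT.
    (* Otherwise the midpoint between the larger left end and the smaller right end lies in both
       intervals. *)
    exfalso; move/eqP : qr; apply; apply: tI => //.
    pose l := Num.max (P q).1 (P r).1; pose u := Num.min (P q).2 (P r).2.
    have lu : l < u by rewrite gt_max !lt_min q1 r1 rq1 qr2.
    exists ((l + u) / 2); rewrite (PI q).2 (PI r).2 /= !in_itv/=.
    have [lm mu'] := midf_lt lu.
    move: (lm) (mu'); rewrite {1}/l {2}/u gt_max lt_min => /andP[-> ->] /andP[-> ->].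
    by [].
  + by apply/allP => q; rewrite mem_filter => /andP[].
  + by rewrite -uniq_pairwise filter_uniq// iota_uniq.
- rewrite -lte_fin; apply: le_lt_trans Ud.
  apply: (@le_trans _ _ (\sum_(0 <= q < n) lebesgue_measure (I q))%E).
    rewrite /s big_map big_filter -sumEFin [leLHS]big_mkcond/= /index_iota subn0.
    apply: lee_sum => q _; have [p12 ->] := PI q.
    rewrite lebesgue_measure_itv/= lte_fin.
    by case: ifPn => // p1p2; rewrite lee_fin; exact: clamp_dist.
  rewrite UI measure_bigcup; [|by move=> q _; exact: mI|exact: tI].
  under eq_eseriesl do rewrite in_setT.
  exact: nneseries_lim_ge.
Qed.

(** By outer regularity a Lebesgue null set lies in an open set of Lebesgue measure below [d], whose
    [mu]-measure is at most [e]. *)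
Let mu_null : mu `<< @lebesgue_measure R.
Proof.
apply/null_content_dominatesP => N mN N0.
apply/eqP; rewrite eq_le measure_ge0 andbT; apply/lee_addgt0Pr => e e0.
rewrite add0e.
have [d d0 H] := Vac e0.
have [|U [oU NU UN]] := lebesgue_regularity_outer mN _ d0; first by rewrite N0 ltry.
apply: (@le_trans _ _ (mu U)).
  by apply: le_measure; rewrite ?inE; [exact: mN|exact: open_measurable|exact: NU].
apply: (mu_open H oU).
(* Regularity bounds only the measure of the difference of [U] and [N]; adding the null set [N] back
   does not change it. *)
have mU := open_measurable oU.
have UE : (U `\` N) `|` N = U by rewrite setUC setDUK.
rewrite -UE; rewrite measureU0//; exact: measurableD.
Qed.

Lemma monotone_absolutely_continuous_density : exists h : R -> R,
  (@lebesgue_measure R).-integrable setT (EFin \o h) /\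
  forall x, a <= x -> x <= b ->
    V x - V a = \int[@lebesgue_measure R]_(t in `]a, x]) h t.
Proof.
have mD : measurable (`]a, b]%classic : set (measurableTypeR R)) by exact: measurable_itv.
have Dfin : (mu `]a, b]%classic < +oo)%E by rewrite mu_itvoc// ltry.
(* Restriction to []a, b]] yields a finite measure, hence a charge with a Radon-Nikodym
   derivative. *)
pose nu := mfrestr mD Dfin.
have numu : charge_of_finite_measure nu `<< @lebesgue_measure R.
  apply/null_content_dominatesP => N mN N0.
  rewrite /charge_of_finite_measure/= /nu /mfrestr /mrestr.
  apply/eqP; rewrite eq_le measure_ge0 andbT.
  have /null_content_dominatesP/(_ N mN N0) <- := mu_null.
  by apply: le_measure; rewrite ?inE//; exact: measurableI.
pose k := Radon_Nikodym (charge_of_finite_measure nu) (@lebesgue_measure R).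
have kint : (@lebesgue_measure R).-integrable setT k by exact: Radon_Nikodym_integrable.
have kE : EFin \o (fine \o k) = k.
  by apply/funext => x /=; rewrite fineK// Radon_Nikodym_fin_num.
exists (fine \o k); rewrite kE; split=> // x ax xb.
rewrite /Rintegral.
have -> : (\int[lebesgue_measure]_(t in `]a, x]) ((fine \o k) t)%:E =
           nu `]a, x]%classic)%E.
  rewrite -[LHS]/(\int[lebesgue_measure]_(t in `]a, x]) (EFin \o (fine \o k)) t)%E kE.
  by rewrite -Radon_Nikodym_integral.
rewrite /nu /mfrestr /mrestr (_ : _ `&` _ = `]a, x]%classic); last first.
  by apply/setIidPl; apply: subset_itvl; rewrite bnd_simp.
by rewrite mu_itvoc//= /F !clamp_id.
Qed.

End monotone_density.

(** * The fundamental theorem of calculus for absolutely continuous functions *)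

(** Jordan decomposition: with [V] the variation of [f] from [a], both [V] and [V \- f] are
    nondecreasing and absolutely continuous, since increments of [f] are dominated by those of
    [V]. *)
Lemma absolutely_continuous_density {R : realType} (a b : R) (f : R -> R) :
  a <= b -> absolutely_continuous_on a b f ->
  exists h : R -> R, (@lebesgue_measure R).-integrable setT (EFin \o h) /\
    forall x, a <= x -> x <= b ->
      f x - f a = \int[@lebesgue_measure R]_(t in `]a, x]) h t.
Proof.
move=> ab fac; have bvf := absolutely_continuous_bounded_variation ab fac.
pose V x := fine (total_variation a x f).
have VE x y : a <= x -> x <= y -> y <= b ->
    total_variation x y f = (V y - V x)%:E.
  move=> ax xy yb.
  have fin z : a <= z -> z <= b -> total_variation a z f \is a fin_num.
    by move=> az zb; apply/bounded_variationP => //; exact: bounded_variationl bvf.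
  have := total_variationD f ax xy; rewrite -(fineK (fin _ (le_trans ax xy) yb)).
  rewrite -(fineK (fin _ ax (le_trans xy yb))) -/(V y) -/(V x) => Vyx.
  by rewrite EFinB Vyx addeAC subee// add0e.
have fV x y : a <= x -> x <= y -> y <= b -> `|f y - f x| <= V y - V x.
  by move=> ax xy yb; rewrite -lee_fin -VE// total_variation_ge.
have Vac : seq_absolutely_continuous a b V.
  move=> e /(absolutely_continuous_total_variation fac)[d d0 H].
  exists d => // s abs sd; rewrite -lee_fin -sumEFin.
  apply: le_trans (H s abs sd); rewrite big_seq [leRHS]big_seq.
  apply: lee_sum => p ps.
  have /andP[/allP/(_ p ps)/and3P[ap pp pb] _] := abs.
  rewrite VE// lee_fin ger0_norm// subr_ge0 -subr_ge0.
  exact: le_trans (fV _ _ ap pp pb).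
have Wac : seq_absolutely_continuous a b (V \- f).
  move=> e e0; have e20 : 0 < e / 2 by rewrite divr_gt0.
  have [d d0 H] := Vac _ e20; have [d' d'0 H'] := absolutely_continuous_on_seq fac e20.
  exists (Num.min d d'); first by rewrite lt_min d0.
  move=> s abs; rewrite lt_min => /andP[sd sd'].
  rewrite (splitr e); apply: le_trans (lerD (H s abs sd) (ltW (H' s abs sd'))).
  rewrite -big_split/=; apply: ler_sum => p _.
  have -> : (V \- f) p.2 - (V \- f) p.1 = (V p.2 - V p.1) - (f p.2 - f p.1).
    by rewrite /=; ring.
  exact: ler_normB.
have [||k [ki kE]] := @monotone_absolutely_continuous_density _ a b V ab.
- move=> x y; rewrite !in_itv/= => /andP[ax _] /andP[_ yb] xy.
  by rewrite -subr_ge0; exact: le_trans (fV _ _ ax xy yb).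
- exact: Vac.
have [||l [li lE]] := @monotone_absolutely_continuous_density _ a b (V \- f) ab.
- move=> x y; rewrite !in_itv/= => /andP[ax _] /andP[_ yb] xy.
  have := le_trans (ler_norm _) (fV _ _ ax xy yb); lra.
- exact: Wac.
exists (k \- l); split; first exact: (integrableB measurableT ki li).
move=> x ax xb; rewrite RintegralB//; last 2 first.
- exact: integrableS ki.
- exact: integrableS li.
by rewrite -kE// -lE//=; lra.
Qed.

(** Almost every point is a Lebesgue point of [h], and there the indefinite integral has derivative
    [h x]; near an interior point [f] differs from it by the constant [f a]. *)
Lemma absolutely_continuous_ae_derivable {R : realType} (a b : R) (f h : R -> R) :
  (@lebesgue_measure R).-integrable setT (EFin \o h) ->
  (forall x, a <= x -> x <= b ->
      f x - f a = \int[@lebesgue_measure R]_(t in `]a, x]) h t) ->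
  {ae @lebesgue_measure R, forall x, a < x -> x < b -> is_derive x 1 f (h x)}.
Proof.
move=> hi fE.
have hloc : locally_integrable setT h.
  by apply: open_integrable_locally => //; exact: openT.
have := lebesgue_differentiation hloc.
apply: (@filterS _ _ (ae_filter_ringOfSetsType (@lebesgue_measure R))).
move=> x hx ax xb.
have hab : (@lebesgue_measure R).-integrable `]a, b] (EFin \o h) by exact: integrableS hi.
have aBx : (BRight a < BRight x)%O by rewrite bnd_simp.
have [dF F'] := FTC1_lebesgue_pt xb hab aBx hx.
pose F y := \int[@lebesgue_measure R]_(t in `]a, y]) h t.
have DF : is_derive x 1 (fun y => f a + F y) (h x).
  rewrite -[h x]add0r; apply: is_deriveD.
  by split; [exact: dF|rewrite -derive1E; exact: F'].
have nE : {near x, (fun y => f a + F y) =1 f}.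
  near=> y; rewrite /F -fE; first by rewrite addrC subrK.
  - by apply: ltW; near: y; exact: lt_nbhsr.
  - by apply: ltW; near: y; exact: lt_nbhsl.
case: DF => dG <-; split; first exact: near_eq_derivable nE dG.
by apply: near_eq_derive; apply: filterS nE => y ->.
Unshelve. all: by end_near. Qed.

Lemma absolutely_continuous_continuous {R : realType} (a b : R) (f : R -> R) :
  absolutely_continuous_on a b f -> {within `[a, b], continuous f}.
Proof.
move=> /absolutely_continuous_on_seq fac; apply/subspace_continuousP => x /=.
rewrite in_itv/= => /andP[ax xb].
apply/cvgrPdist_lt => e /fac[d d0 H].
have close y z : a <= y -> y <= z -> z <= b -> z - y < d -> `|f y - f z| < e.
  move=> ay yz zb zyd; rewrite distrC; have := H [:: (y, z)].
  by rewrite subintervals1 !big_seq1/= ay yz zb; exact.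
rewrite near_withinE; near=> y; rewrite /= in_itv/= => /andP[ay yb].
have : `|x - y| < d by near: y; exact: cvgr_dist_lt.
have [xy|/ltW yx] := leP x y.
  by rewrite distrC ger0_norm ?subr_ge0//; exact: close.
by rewrite ger0_norm ?subr_ge0// distrC; exact: close.
Unshelve. all: by end_near. Qed.

(** * Absolute continuity of the log-coordinate *)

Lemma ln_dist {R : realType} (m x y : R) : 0 < m -> m <= x -> m <= y ->
  `|ln y - ln x| <= `|y - x| / m.
Proof.
move=> m0; wlog xy : x y / x <= y.
  move=> W mx my; have [xy|/ltW yx] := leP x y; first exact: W.
  by rewrite distrC (distrC y); exact: W.
move=> mx my; have x0 : 0 < x by exact: lt_le_trans mx.
have y0 : 0 < y by exact: lt_le_trans my.
rewrite !ger0_norm ?subr_ge0 ?ler_ln ?posrE//.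
rewrite -ln_div ?posrE// (_ : y / x = 1 + (y - x) / x); last by field; rewrite gt_eqF.
apply: le_trans (le_ln1Dx _) _.
  by rewrite (lt_le_trans (ltrN10 _))// divr_ge0 ?subr_ge0// ltW.
by rewrite ler_wpM2l ?subr_ge0// lef_pV2 ?posrE.
Qed.

(** The path attains a positive minimum [g c], and [ln] is Lipschitz with constant [1 / g c] above
    it. *)
Lemma absolutely_continuous_ln {R : realType} (a b : R) (g : R -> R) :
  a <= b -> absolutely_continuous_on a b g -> {in `[a, b], forall t, 0 < g t} ->
  absolutely_continuous_on a b (logc g).
Proof.
move=> ab gac g0.
have [c cab cmin] := EVT_min ab (absolutely_continuous_continuous gac).
have m0 := g0 c cab; move=> e e0.
have [d d0 H] := gac (e * g c) (mulr_gt0 e0 m0).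
exists d => // n u v uv dis sd.
rewrite -(ltr_pM2r m0); apply: le_lt_trans (H n u v uv dis sd).
rewrite mulr_suml; apply: ler_sum => i _; have [au ui vb] := uv i.
rewrite -ler_pdivlMr//; apply: ln_dist => //; apply: cmin; rewrite in_itv/=.
  by rewrite au (le_trans ui).
by rewrite vb (le_trans au).
Qed.

(** * Strong convexity of the kinetic integrand *)

Section kinetic_convexity.
Context {R : realType}.
Implicit Types v x y z s : R.

(* The derivative of [kinK v - v ^+ 2 / 2]. *)
Definition sinh_sub_id v : R := (expR v - expR (- v)) / 2 - v.

(** The difference of the two sides vanishes at 0 and has derivative [(expR c - 1) ^+ 2 / expR c],
    positive for [c > 0]. *)
Lemma expRB_gt v : 0 < v -> 2 * v < expR v - expR (- v).
Proof.
move=> v0.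
pose f x : R := expR x - expR (- x) - 2 * x.
have df x : is_derive x 1 f (expR x + expR (- x) - 2).
  by apply: is_derive_eq; rewrite /GRing.scale/=; ring.
have cf : {within `[0, v], continuous f}.
  by apply: derivable_within_continuous => t _; case: (df t).
have [c /[!in_itv]/= /andP[c0 cv]] := MVT v0 (fun x _ => df x) cf.
rewrite /f oppr0 subrr mulr0 !subr0 -subr_gt0 => ->.
rewrite addr0 mulr_gt0// expRN.
have e1 : 1 < expR c by rewrite expR_gt1.
have e0 : 0 < expR c by exact: expR_gt0.
rewrite (_ : _ - 2 = (expR c - 1) ^+ 2 / expR c); last by field; rewrite gt_eqF.
by rewrite divr_gt0// exprn_gt0// subr_gt0.
Qed.

(** With midpoint [m] and half-difference [w], sinh y - sinh x = 2 cosh m sinh w, which is at least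
    2 sinh w and hence exceeds 2w = y - x. *)
Lemma sinh_sub_id_lt x y : x < y -> sinh_sub_id x < sinh_sub_id y.
Proof.
move=> xy; rewrite -subr_gt0.
pose m := (x + y) / 2; pose w := (y - x) / 2.
have w0 : 0 < w by rewrite divr_gt0// subr_gt0.
have := expRB_gt w0.
have yE : y = m + w by rewrite /m /w; field.
have xE : x = m - w by rewrite /m /w; field.
rewrite /sinh_sub_id xE yE !opprD !opprK !expRD !expRN.
have m1 : 2 <= expR m + (expR m)^-1.
  have e0 : 0 < expR m by exact: expR_gt0.
  rewrite -subr_ge0 (_ : _ - _ = (expR m - 1) ^+ 2 / expR m); last by field; rewrite gt_eqF.
  by rewrite divr_ge0// ?sqr_ge0// ltW.
set E := expR m in m1 *; set F := expR w; set E' := E^-1 in m1 *; set F' := F^-1 => h.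
have h0 : 0 < F - F' by apply: lt_trans h; rewrite mulr_gt0.
have key : 2 * (F - F') <= (E + E') * (F - F') by rewrite ler_wpM2r// ltW.
lra.
Qed.

(** The function [f] below has a strictly increasing derivative, so it lies strictly above its
    tangent at [z]; the quadratic terms are then regrouped. *)
Lemma kinK_tangent y z : y != z ->
  kinK z + sinh_sub_id z * (y - z) + (y ^+ 2 - z ^+ 2) / 2 < kinK y.
Proof.
pose f x : R := kinK x - x ^+ 2 / 2.
have df x : is_derive x 1 f (sinh_sub_id x).
  by rewrite /f /kinK /cosh /sinh_sub_id; apply: is_derive_eq; rewrite /GRing.scale/=; field.
have cf u v : {within `[u, v], continuous f}.
  by apply: derivable_within_continuous => t _; case: (df t).
suff : y != z -> sinh_sub_id z * (y - z) < f y - f z by rewrite /f => H /H; lra.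
rewrite neq_lt => /orP[yz|zy].
  have [c /[!in_itv]/= /andP[yc cz]] := MVT yz (fun x _ => df x) (cf _ _).
  rewrite -opprB => /eqP; rewrite eqr_oppLR => /eqP ->.
  by rewrite -mulrN opprB ltr_nM2r ?subr_lt0// sinh_sub_id_lt.
have [c /[!in_itv]/= /andP[zc cy] ->] := MVT zy (fun x _ => df x) (cf _ _).
by rewrite ltr_pM2r ?subr_gt0// sinh_sub_id_lt.
Qed.

(** The tangent inequalities at the mean [z] are added with weights [1 - s] and [s]: the linear
    terms cancel, and the quadratic ones sum to [s * (1 - s) / 2 * (x - y) ^+ 2]. *)
Lemma kinK_strict_convex x y s : 0 < s < 1 -> x != y ->
  kinK ((1 - s) * x + s * y) <
  (1 - s) * kinK x + s * kinK y - s * (1 - s) / 2 * (x - y) ^+ 2.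
Proof.
move=> /andP[s0 s1] xy; set z := _ + _.
have xz : x != z.
  rewrite -subr_eq0 (_ : x - z = s * (x - y)); last by rewrite /z; ring.
  by rewrite mulf_neq0 ?subr_eq0// gt_eqF.
have yz : y != z.
  rewrite -subr_eq0 (_ : y - z = (1 - s) * (y - x)); last by rewrite /z; ring.
  by rewrite mulf_neq0 ?subr_eq0 1?eq_sym// lt_eqF.
have s1' : 0 < 1 - s by rewrite subr_gt0.
have hx : (1 - s) * (kinK z + sinh_sub_id z * (x - z) + (x ^+ 2 - z ^+ 2) / 2) < (1 - s) * kinK x.
  by rewrite ltr_pM2l// kinK_tangent.
have hy : s * (kinK z + sinh_sub_id z * (y - z) + (y ^+ 2 - z ^+ 2) / 2) < s * kinK y.
  by rewrite ltr_pM2l// kinK_tangent.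
rewrite ltrBrDr; apply: le_lt_trans (ltrD hx hy); rewrite le_eqVlt; apply/orP; left; apply/eqP.
by rewrite /z; field.
Qed.

Lemma kinK_convex x y s : 0 <= s <= 1 ->
  kinK ((1 - s) * x + s * y) <=
  (1 - s) * kinK x + s * kinK y - s * (1 - s) / 2 * (x - y) ^+ 2.
Proof.
move=> /andP[]; rewrite le_eqVlt => /predU1P[<- _|s0].
  by rewrite le_eqVlt; apply/orP; left; apply/eqP; rewrite subr0 !mul1r !mul0r !addr0; ring.
rewrite le_eqVlt => /predU1P[->|s1].
  by rewrite le_eqVlt; apply/orP; left; apply/eqP; rewrite subrr !mul1r !mul0r !add0r; ring.
have [<-|xy] := eqVneq x y; last by apply/ltW/kinK_strict_convex; rewrite ?s0.
rewrite le_eqVlt; apply/orP; left; apply/eqP.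
by rewrite (_ : (1 - s) * x + s * x = x); ring.
Qed.

(** This is the tangent inequality at 0. It makes a finite action control the squared
    log-derivative. *)
Lemma kinK_ge_sqr v : v ^+ 2 / 2 <= kinK v.
Proof.
have [->|v0] := eqVneq v 0.
  by rewrite /kinK /cosh oppr0 expR0; lra.
have := kinK_tangent v0.
rewrite /sinh_sub_id /kinK /cosh !oppr0 expR0 expr0n/=; lra.
Qed.

Lemma kinK_ge0 v : 0 <= kinK v.
Proof. by apply: le_trans (kinK_ge_sqr v); rewrite divr_ge0 ?sqr_ge0. Qed.

End kinetic_convexity.

(** * Integration of the convexity inequality *)

Lemma measurable_kinK {R : realType} : measurable_fun setT (@kinK R).
Proof.
apply: measurable_funB => //; apply: measurable_funM => //.
by apply: measurable_funD; [exact: measurable_expR|exact: measurableT_comp].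
Qed.

(* The smaller function need not be measurable: its integral is a supremum of
   integrals of simple functions below it. *)
Lemma ge0_le_integral_ae d (T : measurableType d) (R : realType)
    (mu : {measure set T -> \bar R}) (D : set T) (f g : T -> \bar R) :
  measurable D -> (forall x, D x -> 0 <= f x)%E -> (forall x, D x -> 0 <= g x)%E ->
  measurable_fun D g -> {ae mu, forall x, D x -> (f x <= g x)%E} ->
  (\int[mu]_(x in D) f x <= \int[mu]_(x in D) g x)%E.
Proof.
move=> mD f0 g0 mg fg; rewrite ge0_integralE//.
apply: ge_ereal_sup => _ [k /= kf <-].
rewrite -integralT_nnsfun [leRHS]integral_mkcond.
apply: ae_ge0_le_integral => //.
- by move=> x _; rewrite lee_fin; exact: fun_ge0.
- exact/measurable_EFinP.
- by move=> x _; rewrite patchE; case: ifPn => // /set_mem; exact: g0.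
- exact/(measurable_restrictT _ mD).
- move: fg; apply: (@filterS _ _ (ae_filter_ringOfSetsType mu)) => x fgx _.
  by have := kf x; rewrite !patchE; case: ifPn => // /set_mem Dx /le_trans; apply; exact: fgx.
Qed.

Section integral_convexity.
Context d (T : measurableType d) (R : realType) (mu : {measure set T -> \bar R}).
Variables (D : set T) (h1 h2 : T -> R).
Hypotheses (mD : measurable D) (mh1 : measurable_fun D h1) (mh2 : measurable_fun D h2).
Hypotheses (i1 : mu.-integrable D (fun t => (kinK (h1 t))%:E))
           (i2 : mu.-integrable D (fun t => (kinK (h2 t))%:E)).

(** The square of x - y is at most 2x^2 + 2y^2, hence at most four times the sum of the kinetic
    terms. *)
Lemma integrable_sqr_sub : mu.-integrable D (fun t => ((h1 t - h2 t) ^+ 2)%:E).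
Proof.
have i12 : mu.-integrable D
    (fun t => 4%:E * (kinK (h1 t))%:E + 4%:E * (kinK (h2 t))%:E)%E.
  by apply: integrableD => //; exact: integrableZl.
apply: le_integrable i12 => //.
  apply/measurable_EFinP; apply: measurable_funX; exact: measurable_funB.
move=> t _; rewrite -!EFinM -EFinD !abse_EFin lee_fin.
rewrite ger0_norm ?sqr_ge0// ger0_norm ?addr_ge0 ?mulr_ge0 ?kinK_ge0//.
have := kinK_ge_sqr (h1 t); have := kinK_ge_sqr (h2 t).
have := sqr_ge0 (h1 t + h2 t); rewrite sqrrB sqrrD; lra.
Qed.

Let mix s t := kinK ((1 - s) * h1 t + s * h2 t).
Let bound s t := (1 - s) * kinK (h1 t) + s * kinK (h2 t) -
  s * (1 - s) / 2 * (h1 t - h2 t) ^+ 2.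

Let mmix s : measurable_fun D (mix s).
Proof.
apply: (measurableT_comp measurable_kinK).
by apply: measurable_funD; exact: measurable_funM.
Qed.

Let ibound s : mu.-integrable D (fun t => (bound s t)%:E).
Proof.
rewrite /bound; under eq_fun do rewrite EFinB EFinD !EFinM.
apply: integrableB => //; last by apply: integrableZl => //; exact: integrable_sqr_sub.
by apply: integrableD => //; exact: integrableZl.
Qed.

Let int_bound s : (\int[mu]_(t in D) (bound s t)%:E =
  (1 - s)%:E * \int[mu]_(t in D) (kinK (h1 t))%:E
  + s%:E * \int[mu]_(t in D) (kinK (h2 t))%:E
  - (s * (1 - s) / 2)%:E * \int[mu]_(t in D) ((h1 t - h2 t) ^+ 2)%:E)%E.
Proof.
rewrite /bound; under eq_integral do rewrite EFinB EFinD !EFinM.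
have iq := integrable_sqr_sub.
have j1 := integrableZl mD (1 - s) i1; have j2 := integrableZl mD s i2.
have jq := integrableZl mD (s * (1 - s) / 2) iq.
rewrite integralB//; last exact: (integrableD mD j1 j2).
by rewrite integralD// !integralZl.
Qed.

Lemma integral_kinK_convex s : 0 <= s <= 1 ->
  (\int[mu]_(t in D) (kinK ((1 - s) * h1 t + s * h2 t))%:E <=
  (1 - s)%:E * \int[mu]_(t in D) (kinK (h1 t))%:E
  + s%:E * \int[mu]_(t in D) (kinK (h2 t))%:E
  - (s * (1 - s) / 2)%:E * \int[mu]_(t in D) ((h1 t - h2 t) ^+ 2)%:E)%E.
Proof.
move=> s01; rewrite -int_bound; apply: ge0_le_integral => //.
- by move=> t _; rewrite lee_fin kinK_ge0.
- exact/measurable_EFinP/mmix.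
- exact: measurable_int (ibound s).
- by move=> t _; rewrite lee_fin kinK_convex.
Qed.

Lemma integral_kinK_strict_convex s : 0 < s < 1 -> ~ ae_eq mu D h1 h2 ->
  (\int[mu]_(t in D) (kinK ((1 - s) * h1 t + s * h2 t))%:E <
  (1 - s)%:E * \int[mu]_(t in D) (kinK (h1 t))%:E
  + s%:E * \int[mu]_(t in D) (kinK (h2 t))%:E
  - (s * (1 - s) / 2)%:E * \int[mu]_(t in D) ((h1 t - h2 t) ^+ 2)%:E)%E.
Proof.
move=> s01 h12; rewrite -int_bound.
have s01' : 0 <= s <= 1 by case/andP: s01 => s0 s1; rewrite !ltW.
(* As [mix] lies between 0 and [bound], it is integrable and the two integrals may be subtracted. *)
have imix : mu.-integrable D (fun t => (mix s t)%:E).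
  apply: le_integrable (ibound s) => //; first exact/measurable_EFinP/mmix.
  move=> t _; rewrite !abse_EFin lee_fin ger0_norm ?kinK_ge0//.
  by apply: le_trans (ler_norm _); exact: kinK_convex.
have gap0 t : 0 <= bound s t - mix s t by rewrite subr_ge0 kinK_convex.
rewrite -sube_gt0.
rewrite -integralB//.
under eq_integral do rewrite -EFinB.
rewrite lt_neqAle integral_ge0 ?andbT; last by move=> t _; rewrite lee_fin.
(* A nonnegative gap with zero integral vanishes almost everywhere, and pointwise strictness then
   forces [h1 t = h2 t]. *)
apply/eqP => gap; apply: h12.
have mgap : measurable_fun D (fun t => (bound s t - mix s t)%:E).
  exact: measurable_int (integrableB mD (ibound s) imix).
have /(ae_eq_integral_abs _ mD mgap) :
    (\int[mu]_(t in D) `|(bound s t - mix s t)%:E|)%E = 0%E.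
  by rewrite [RHS]gap; apply: eq_integral => t _; rewrite gee0_abs ?lee_fin.
apply: (@filterS _ _ (ae_filter_ringOfSetsType mu)) => t /[apply].
rewrite /= => -[]; have [//|h12] := eqVneq (h1 t) (h2 t).
by move/eqP; rewrite subr_eq0 gt_eqF// kinK_strict_convex.
Qed.

End integral_convexity.

(** * Transfer between pointwise log-derivatives and densities *)

Lemma ae_itvcc {R : realType} (a b : R) (P : R -> Prop) :
  {ae @lebesgue_measure R, forall t, a < t -> t < b -> P t} ->
  {ae @lebesgue_measure R, forall t, `[a, b]%classic t -> P t}.
Proof.
move=> Pab.
have ae_neq (c : R) : {ae @lebesgue_measure R, forall t, t <> c}.
  exists [set c]; split; [exact: measurable_set1|exact: lebesgue_measure_set1|].
  by move=> t /= /contrapT.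
move: Pab (ae_neq a) (ae_neq b).
apply: (@filterS3 _ _ (ae_filter_ringOfSetsType (@lebesgue_measure R))).
move=> t Pt ta tb /=; rewrite in_itv/= !le_eqVlt.
by move=> /andP[/predU1P[/esym//|a_t] /predU1P[//|tb']]; exact: Pt.
Qed.

Section log_derivative.
Context {R : realType} (a b : R).
Implicit Types (g h : R -> R) (s t : R).
Hypothesis ab : a <= b.

Local Notation mu := (@lebesgue_measure R).
Local Notation D := (`[a, b]%classic : set R).

(** A measurable representative of the log-derivative. The integral formula is kept beside the
    derivative because it recovers [logc g] up to a constant. *)
Definition log_density (g h : R -> R) :=
  [/\ mu.-integrable setT (EFin \o h),
      forall x, a <= x -> x <= b -> logc g x - logc g a = \int[mu]_(t in `]a, x]) h t
    & {ae mu, forall t, a < t -> t < b -> is_derive t 1 (logc g) (h t)}].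

Lemma admissible_log_density g : admissible a b g -> exists h, log_density g h.
Proof.
case=> gac g0 _.
have [h [hi hE]] := absolutely_continuous_density ab (absolutely_continuous_ln ab gac g0).
by exists h; split => //; exact: absolutely_continuous_ae_derivable hE.
Qed.

Lemma log_density_measurable g h : log_density g h -> measurable_fun setT h.
Proof. by case=> /measurable_int/measurable_EFinP. Qed.

Lemma log_density_derive1 g h : log_density g h -> ae_eq mu D (derive1 (logc g)) h.
Proof.
case=> _ _ gh; apply: ae_itvcc; move: gh.
apply: (@filterS _ _ (ae_filter_ringOfSetsType mu)) => t gh a_t tb.
by rewrite derive1E; have ? := gh a_t tb; exact: derive_val.
Qed.

Let mD : measurable D. Proof. exact: measurable_itv. Qed.

(** Kinetic admissibility includes measurability of the original integrand, so here the almost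
    everywhere equality gives equal integrals. *)
Lemma kinK_density g h : log_density g h -> kinetically_admissible a b g ->
  mu.-integrable D (fun t => (kinK (h t))%:E) /\
  action a b g = (\int[mu]_(t in D) (kinK (h t))%:E)%E.
Proof.
move=> gh [_ ig].
have mh : measurable_fun D (fun t => (kinK (h t))%:E).
  apply/measurable_EFinP; apply: (measurableT_comp measurable_kinK).
  by apply: measurable_funTS; exact: log_density_measurable gh.
have gE : ae_eq mu D (fun t => (kinK (derive1 (logc g) t))%:E) (fun t => (kinK (h t))%:E).
  move: (log_density_derive1 gh).
  by apply: (@filterS _ _ (ae_filter_ringOfSetsType mu)) => t gh_t Dt; rewrite (gh_t Dt).
have AE : action a b g = (\int[mu]_(t in D) (kinK (h t))%:E)%E.
  by apply: ae_eq_integral => //; exact: measurable_int ig.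
split=> //; apply/integrableP; split=> //.
under eq_integral do rewrite gee0_abs ?lee_fin ?kinK_ge0//.
rewrite -AE; case/integrableP: ig => _; rewrite /action.
by under eq_integral do rewrite gee0_abs ?lee_fin ?kinK_ge0//.
Qed.

Lemma logc_interp g1 g2 s t : 0 < g1 t -> 0 < g2 t ->
  logc (interp g1 g2 s) t = (1 - s) * logc g1 t + s * logc g2 t.
Proof.
by move=> g1t g2t; rewrite /logc /interp lnM ?posrE ?powR_gt0// !ln_powR.
Qed.

Let near_pos g t : {in `[a, b], forall x, 0 < g x} -> a < t -> t < b ->
  \forall x \near t, 0 < g x.
Proof.
move=> g0 a_t tb; near=> x; apply: g0; rewrite in_itv/=; apply/andP; split.
  by apply: ltW; near: x; exact: lt_nbhsr.
by apply: ltW; near: x; exact: lt_nbhsl.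
Unshelve. all: by end_near. Qed.

Lemma derive1_logc_interp g1 g2 s t (u v : R) :
  {in `[a, b], forall x, 0 < g1 x} -> {in `[a, b], forall x, 0 < g2 x} ->
  a < t -> t < b -> is_derive t 1 (logc g1) u -> is_derive t 1 (logc g2) v ->
  derive1 (logc (interp g1 g2 s)) t = (1 - s) * u + s * v.
Proof.
move=> g10 g20 a_t tb d1 d2.
pose f y := (1 - s) * logc g1 y + s * logc g2 y.
have nE : \forall x \near t, logc (interp g1 g2 s) x = f x.
  (* The log-coordinate is affine in [s] only where both paths are positive, which holds near an
     interior point. *)
  by near=> x; apply: logc_interp; near: x; exact: near_pos.
rewrite derive1E (near_eq_derive (1 : R) nE).
have df : is_derive t 1 f ((1 - s) * u + s * v).
  by apply: is_derive_eq; rewrite /GRing.scale/=; ring.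
exact: derive_val.
Unshelve. all: by end_near. Qed.

Lemma derive1_logc_ratio g1 g2 (c : R) t :
  {in `[a, b], forall x, 0 < g1 x} -> {in `[a, b], forall x, 0 < g2 x} ->
  {in `[a, b], forall x, g2 x / g1 x = c} -> a < t -> t < b ->
  derivable (logc g1) t 1 -> derive1 (logc g1) t = derive1 (logc g2) t.
Proof.
move=> g10 g20 cE a_t tb d1.
have tab : t \in `[a, b] by rewrite in_itv/= !ltW.
have c0 : 0 < c by rewrite -(cE t)// divr_gt0 ?g10 ?g20.
pose f y := ln c + logc g1 y.
have nE : \forall x \near t, logc g2 x = f x.
  near=> x.
  have xab : x \in `[a, b].
    rewrite in_itv/=; apply/andP; split.
      by apply: ltW; near: x; exact: lt_nbhsr.
    by apply: ltW; near: x; exact: lt_nbhsl.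
  by rewrite /f /logc -lnM ?posrE ?g10// -(cE x)// divfK// gt_eqF// g10.
rewrite !derive1E (near_eq_derive (1 : R) nE).
have d1' : is_derive t 1 (logc g1) ('D_1 (logc g1) t) by split.
have df : is_derive t 1 f ('D_1 (logc g1) t).
  by apply: is_derive_eq; rewrite add0r mul1r.
by case: df.
Unshelve. all: by end_near. Qed.

Lemma action_interp_le g1 g2 h1 h2 s :
  {in `[a, b], forall x, 0 < g1 x} -> {in `[a, b], forall x, 0 < g2 x} ->
  log_density g1 h1 -> log_density g2 h2 ->
  (action a b (interp g1 g2 s) <=
   \int[mu]_(t in D) (kinK ((1 - s) * h1 t + s * h2 t))%:E)%E.
Proof.
move=> g10 g20 gh1 gh2; apply: ge0_le_integral_ae => //.
- by move=> t _; rewrite lee_fin kinK_ge0.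
- by move=> t _; rewrite lee_fin kinK_ge0.
- apply/measurable_EFinP; apply: (measurableT_comp measurable_kinK).
  apply: measurable_funTS; apply: measurable_funD; apply: measurable_funM => //;
    [exact: log_density_measurable gh1|exact: log_density_measurable gh2].
- apply: ae_itvcc; case: gh1 gh2 => _ _ d1 [_ _]; move: d1.
  apply: (@filterS2 _ _ (ae_filter_ringOfSetsType mu)) => t d1 d2 a_t tb.
  have {}d1 := d1 a_t tb; have {}d2 := d2 a_t tb.
  by rewrite (derive1_logc_interp _ g10 g20 a_t tb d1 d2).
Qed.

Lemma integral_sqr_derive_le g1 g2 h1 h2 :
  log_density g1 h1 -> log_density g2 h2 ->
  (\int[mu]_(t in D) ((derive1 (logc g1) t - derive1 (logc g2) t) ^+ 2)%:E <=
   \int[mu]_(t in D) ((h1 t - h2 t) ^+ 2)%:E)%E.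
Proof.
move=> gh1 gh2; apply: ge0_le_integral_ae => //.
- by move=> t _; rewrite lee_fin sqr_ge0.
- by move=> t _; rewrite lee_fin sqr_ge0.
- apply/measurable_EFinP/measurable_funTS/measurable_funX.
  by apply: measurable_funB; [exact: log_density_measurable gh1|exact: log_density_measurable gh2].
- move: (log_density_derive1 gh1) (log_density_derive1 gh2).
  apply: (@filterS2 _ _ (ae_filter_ringOfSetsType mu)) => t e1 e2 Dt.
  by rewrite e1// e2.
Qed.

(** The squared difference enters with a nonpositive coefficient, so its upper bound becomes a lower
    bound here. *)
Lemma interp_bound_ge g1 g2 h1 h2 s : 0 <= s <= 1 ->
  kinetically_admissible a b g1 -> kinetically_admissible a b g2 ->
  log_density g1 h1 -> log_density g2 h2 ->
  ((1 - s)%:E * \int[mu]_(t in D) (kinK (h1 t))%:E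
  + s%:E * \int[mu]_(t in D) (kinK (h2 t))%:E
  - (s * (1 - s) / 2)%:E * \int[mu]_(t in D) ((h1 t - h2 t) ^+ 2)%:E <=
  interp_bound a b g1 g2 s)%E.
Proof.
move=> /andP[s0 s1] kg1 kg2 gh1 gh2; rewrite /interp_bound.
rewrite (kinK_density gh1 kg1).2 (kinK_density gh2 kg2).2.
apply: leeB => //; apply: lee_wpmul2l; last exact: integral_sqr_derive_le gh1 gh2.
by rewrite lee_fin divr_ge0// mulr_ge0// subr_ge0.
Qed.

(** Equal densities give equal increments of the two log-coordinates from [a], so the logarithm of
    the ratio keeps its value at [a]. Conversely, a constant ratio shifts the log-coordinate by a
    constant. *)
Lemma ratio_constant g1 g2 h1 h2 :
  {in `[a, b], forall x, 0 < g1 x} -> {in `[a, b], forall x, 0 < g2 x} ->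
  log_density g1 h1 -> log_density g2 h2 ->
  ae_eq mu D (derive1 (logc g1)) (derive1 (logc g2)) <->
  exists c : R, {in `[a, b], forall t, g2 t / g1 t = c}.
Proof.
move=> g10 g20 gh1 gh2; split.
  move=> d12; have h12 : ae_eq mu D h1 h2.
    apply: ae_eq_trans (ae_eq_sym (log_density_derive1 gh1)) _.
    exact: ae_eq_trans d12 (log_density_derive1 gh2).
  have aab : a \in `[a, b] by rewrite in_itv/= lexx.
  exists (g2 a / g1 a) => x xab.
  have := xab; rewrite in_itv/= => /andP[ax xb].
  apply: ln_inj; rewrite ?posrE ?divr_gt0 ?g10 ?g20//.
  rewrite !ln_div ?posrE ?g10 ?g20//.
  have : logc g1 x - logc g1 a = logc g2 x - logc g2 a.
    case: gh1 gh2 => i1 -> // _ [i2 -> // _]; congr fine.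
    apply: ae_eq_integral => //.
    - by apply: measurable_funTS; exact: measurable_int i1.
    - by apply: measurable_funTS; exact: measurable_int i2.
    - move: h12; apply: (@filterS _ _ (ae_filter_ringOfSetsType mu)) => t h12.
      rewrite /= in_itv/= => /andP[a_t tx]; rewrite h12//=.
      by rewrite /= in_itv/= (ltW a_t) (le_trans tx).
  rewrite /logc; lra.
move=> [c cE]; apply: ae_itvcc; case: gh1 => _ _.
apply: (@filterS _ _ (ae_filter_ringOfSetsType mu)) => t d1 a_t tb.
by have [dt _] := d1 a_t tb; exact: derive1_logc_ratio cE a_t tb dt.
Qed.

End log_derivative.

Theorem theorem4p2 (R : realType) (a b : R) (ltab : a < b) :
  (forall g1 g2 : R -> R,
     kinetically_admissible a b g1 -> kinetically_admissible a b g2 ->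
     [/\ forall s : R, 0 <= s <= 1 ->
           (action a b (interp g1 g2 s) <= interp_bound a b g1 g2 s)%E,
         forall s : R, 0 < s < 1 ->
           ~ ae_eq (@lebesgue_measure R) `[a, b]%classic
               (derive1 (logc g1)) (derive1 (logc g2)) ->
           (action a b (interp g1 g2 s) < interp_bound a b g1 g2 s)%E
       & ae_eq (@lebesgue_measure R) `[a, b]%classic
               (derive1 (logc g1)) (derive1 (logc g2)) <->
         exists c : R, {in `[a, b], forall t, g2 t / g1 t = c}]) /\
  convex_along_interp a b (action a b).
Proof.
have le_ab := ltW ltab.
(* Proved first since it serves both the displayed inequality and convexity. *)
have bound g1 g2 (s : R) : kinetically_admissible a b g1 -> kinetically_admissible a b g2 ->
    0 <= s <= 1 -> (action a b (interp g1 g2 s) <= interp_bound a b g1 g2 s)%E.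
  move=> kg1 kg2 s01; have [[_ g10 _] _] := kg1; have [[_ g20 _] _] := kg2.
  have [h1 gh1] := admissible_log_density le_ab kg1.1.
  have [h2 gh2] := admissible_log_density le_ab kg2.1.
  apply: le_trans (action_interp_le s g10 g20 gh1 gh2) _.
  apply: le_trans (interp_bound_ge s01 kg1 kg2 gh1 gh2).
  apply: integral_kinK_convex => //.
  - by apply: measurable_funTS; exact: log_density_measurable gh1.
  - by apply: measurable_funTS; exact: log_density_measurable gh2.
  - exact: (kinK_density gh1 kg1).1.
  - exact: (kinK_density gh2 kg2).1.
split.
  move=> g1 g2 kg1 kg2; have [[_ g10 _] _] := kg1; have [[_ g20 _] _] := kg2.
  have [h1 gh1] := admissible_log_density le_ab kg1.1.
  have [h2 gh2] := admissible_log_density le_ab kg2.1.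
  split; first by move=> s; exact: bound.
  - move=> s s01 d12.
    have s01' : 0 <= s <= 1 by case/andP: s01 => s0 s1; rewrite !ltW.
    apply: le_lt_trans (action_interp_le s g10 g20 gh1 gh2) _.
    apply: lt_le_trans (interp_bound_ge s01' kg1 kg2 gh1 gh2).
    apply: integral_kinK_strict_convex => //.
    + by apply: measurable_funTS; exact: log_density_measurable gh1.
    + by apply: measurable_funTS; exact: log_density_measurable gh2.
    + exact: (kinK_density gh1 kg1).1.
    + exact: (kinK_density gh2 kg2).1.
    + move=> h12; apply: d12; apply: ae_eq_trans (log_density_derive1 gh1) _.
      exact: ae_eq_trans h12 (ae_eq_sym (log_density_derive1 gh2)).
  - exact: ratio_constant gh1 gh2.
move=> g1 g2 s kg1 kg2 s01; apply: le_trans (bound _ _ _ kg1 kg2 s01) _.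
(* Convexity follows by dropping the subtracted nonnegative term. *)
move: s01 => /andP[s0 s1]; rewrite /interp_bound geeDl// oppe_le0 mule_ge0//.
  by rewrite lee_fin divr_ge0// mulr_ge0// subr_ge0.
by apply: integral_ge0 => t _; rewrite lee_fin sqr_ge0.
Qed.
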